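(* Let $\rho$ be a predicate variable (a predicate symbol that is arbitrary, i.e. may be instantiated by any formula in a derived Hoare triple), let $e$ be a term of type $\mathbf{SetOf}(\mathbf{Ptr})$, let $p$ and $q$ be formulas, let $s$ be a program statement, and let $r$ be a formula (possibly containing pre-state terms). Suppose that (1) the Hoare triple $\mathtt{Outlying}(\rho,e)\land p\ \{\ s\ \}\ \rho\land q$ is derivable, and (2) the implication $p\land\overline{r}\Rightarrow\big(\overline{\mathfrak{M}(r)}\cap e=\emptyset\big)$ holds. Then the Hoare triple $p\land\overline{r}\ \{\ s\ \}\ q\land r$ is derivable.
   Context: The setting is an extension of Hoare logic for pointer programs (''Scope Logic''). Specifications are Hoare triples $p\ \{c\}\ q$ where $c$ is a program fragment and $p,q$ are formulas of the Logic of Partial Functions (a three-valued logic, with $t\!\downarrow$ meaning ''the term $t$ is defined'') that may contain user-defined recursive functions. Memory is modelled by a function $\ast$: for a non-nil pointer $x$, $\ast x$ is the value stored in the memory unit $x$; program variables $v$ denote constant addresses $\&v$, and $\ast$ is interpreted in the pre-state in the pre-condition and in the post-state in the post-condition (so functions defined using $\ast$ are interpreted accordingly). A pre-state term $\overleftarrow{t}$ (for a term $t$ with no pre-state subterm) denotes the value of $t$ evaluated in the pre-state of the execution; in pre-conditions $\overleftarrow{t}$ and $t$ are interchangeable. For a formula or term $Q$, $\overline{Q}$ denotes $Q$ with every pre-state term $\overleftarrow{t}$ replaced by $t$. The memory scope $\mathfrak{M}(t)$ of a term (the set of memory units its value depends on) is defined syntactically: $\mathfrak{M}(\overleftarrow{t})=\emptyset$;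 $\mathfrak{M}(t)=\emptyset$ for logical variables and constants; $\mathfrak{M}(f(t_1,\dots,t_n))=\mathfrak{M}(t_1)\cup\dots\cup\mathfrak{M}(t_n)\cup\mathfrak{M}(f)(t_1,\dots,t_n)$; $\mathfrak{M}(t_0?t_1:t_2)=\mathfrak{M}(t_0)\cup(t_0?\mathfrak{M}(t_1):\mathfrak{M}(t_2))$. The memory scope function $\mathfrak{M}(f)$ is $\lambda\bar x.\emptyset$ for basic/abstract-type operations, address operations and constants, $\mathfrak{M}(\ast)(x)=\{x\}$, and for a recursively defined $f(\bar x)\triangleq t$ it is defined by $\mathfrak{M}(f)(\bar x)\triangleq\mathfrak{M}(t)$. For formulas (with quantified variables renamed apart): $\mathfrak{M}$ of a boolean term is its term scope, $\mathfrak{M}(t_1=t_2)=\mathfrak{M}(t_1==t_2)=\mathfrak{M}(t_1)\cup\mathfrak{M}(t_2)$, $\mathfrak{M}(p_1\land p_2)=\mathfrak{M}(p_1)\cup\mathfrak{M}(p_2)$, $\mathfrak{M}(\neg p)=\mathfrak{M}(p)$, $\mathfrak{M}(\forall x\cdot p)=\mathfrak{M}(p)$. The abbreviation $\mathtt{Outlying}(\rho,e)$ stands for $\rho\land(\mathfrak{M}(\rho)\cap e=\emptyset)$. Derivability is with respect to the logic's rules, which include: substitution of a formula for a predicate variable in a derived triple, the rules allowing $t$ and $\overleftarrow{t}$ to be interchanged in pre-conditions, and the consequence rule (from $P\{s\}Q$, $P'\Rightarrow P$, $Q\Rightarrow Q'$ infer $P'\{s\}Q'$). *)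

(* Defs.v *)
From Stdlib Require List.
From mathcomp Require Import all_boot.
From mathcomp Require Import boolp classical_sets.

Set Implicit Arguments.
Unset Strict Implicit.
Unset Printing Implicit Defensive.

Inductive ty (base : Type) : Type :=
| TBool
| TPtr
| TBase of base
| TSet of ty base.
Arguments TBool {base}.
Arguments TPtr {base}.

(* [sg_op] gathers the operations and constants of basic and abstract types and
   the address operations (e.g. the address of a field); [sg_fn] gathers the
   user-defined functions, whose bodies are given separately. *)
Record signature : Type := Signature {
  sg_base : Type;
  sg_basic : sg_base -> bool;  (* basic, i.e. storable in one memory unit *)
  sg_pvar : Type;
  sg_op : Type;
  op_arity : sg_op -> nat;
  op_dom : forall o, 'I_(op_arity o) -> ty sg_base;
  op_cod : sg_op -> ty sg_base;
  sg_fn : Type;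
  fn_arity : sg_fn -> nat;
  fn_dom : forall f, 'I_(fn_arity f) -> ty sg_base;
  fn_cod : sg_fn -> ty sg_base
}.
Arguments op_dom {s} o i.
Arguments fn_dom {s} f i.

Notation sty S := (ty (sg_base S)).
Notation SetOfPtr := (TSet TPtr).

Definition storable (S : signature) (A : sty S) : bool :=
  match A with
  | TBool | TPtr => true
  | TBase b => sg_basic b
  | TSet _ => false
  end.

(* The memory scope function of a user-defined function is itself recursively
   defined, hence has a memory scope function in turn: [Fn f k] is the [k]-th
   iterated memory scope function of [f], so that [Fn f 0] is [f]. *)
Inductive fsym (S : signature) : Type :=
| Op of sg_op S
| AddrOf of sg_pvar S
| Nil
| Empty of sty S
| Sing of sty S
| Union of sty S
| Inter of sty S
| Deref of sty S
| Fn of sg_fn S & nat.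
Arguments Nil {S}.

Definition farity (S : signature) (f : fsym S) : nat :=
  match f with
  | Op o => op_arity o
  | AddrOf _ | Nil | Empty _ => 0
  | Sing _ | Deref _ => 1
  | Union _ | Inter _ => 2
  | Fn g _ => fn_arity g
  end.

Definition fdom (S : signature) (f : fsym S) : 'I_(farity f) -> sty S :=
  match f return 'I_(farity f) -> sty S with
  | Op o => op_dom o
  | AddrOf _ | Nil | Empty _ => fun=> TBool (* arity 0 *)
  | Sing A => fun=> A
  | Deref _ => fun=> TPtr
  | Union A | Inter A => fun=> TSet A
  | Fn g _ => fn_dom g
  end.

Definition fcod (S : signature) (f : fsym S) : sty S :=
  match f with
  | Op o => op_cod o
  | AddrOf _ | Nil => TPtr
  | Empty A | Sing A | Union A | Inter A => TSet A
  | Deref A => A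
  | Fn g 0 => fn_cod g
  | Fn _ _.+1 => SetOfPtr
  end.

(* [term V b A]: terms of type [A] over variables [V].  At [b = false] neither
   pre-state terms nor scopes of predicate variables occur; these are the terms
   of function definitions and those to which the pre-state arrow applies.
   [PScope rho k] is the [k.+1]-st iterated memory scope of the predicate
   variable [rho]. *)
Inductive term (S : signature) (V : sty S -> Type) : bool -> sty S -> Type :=
| Var b A : V A -> term V b A
| App b f : (forall i, term V b (@fdom S f i)) -> term V b (fcod f)
| Cond b A : term V b TBool -> term V b A -> term V b A -> term V b A
| Pre A : term V false A -> term V true A
| PScope : nat -> nat -> term V true SetOfPtr.
Arguments Var {S V} b {A} x.
Arguments App {S V b} f args.
Arguments Cond {S V b A} c t u.
Arguments Pre {S V A} t.
Arguments PScope {S V} rho k.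

Definition emptyT (S : signature) (V : sty S -> Type) b (A : sty S) :
    term V b (TSet A) :=
  App (Empty A) (fun i => False_rect _ (notF (ltn_ord i))).

Definition singT (S : signature) (V : sty S -> Type) b (A : sty S)
    (t : term V b A) : term V b (TSet A) :=
  App (Sing A) (fun=> t).

Definition unionT (S : signature) (V : sty S -> Type) b (A : sty S)
    (t u : term V b (TSet A)) : term V b (TSet A) :=
  App (Union A) (fun i => if i == ord0 then t else u).

Definition interT (S : signature) (V : sty S -> Type) b (A : sty S)
    (t u : term V b (TSet A)) : term V b (TSet A) :=
  App (Inter A) (fun i => if i == ord0 then t else u).

Fixpoint lift (S : signature) (V : sty S -> Type) b (A : sty S)
    (t : term V b A) : term V true A :=
  match t with
  | Var _ _ x => Var true x
  | App _ f args => App f (fun i => lift (args i))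
  | Cond _ _ c t u => Cond (lift c) (lift t) (lift u)
  | Pre _ t => Pre t
  | PScope rho k => PScope rho k
  end.

Fixpoint tbar (S : signature) (V : sty S -> Type) b (A : sty S)
    (t : term V b A) : term V b A :=
  match t with
  | Var b _ x => Var b x
  | App _ f args => App f (fun i => tbar (args i))
  | Cond _ _ c t u => Cond (tbar c) (tbar t) (tbar u)
  | Pre _ t => lift t
  | PScope rho k => PScope rho k
  end.

Definition fn_scope (S : signature) (V : sty S -> Type) b (f : fsym S) :
    (forall i, term V b (@fdom S f i)) -> term V b SetOfPtr :=
  match f return (forall i, term V b (@fdom S f i)) -> term V b SetOfPtr with
  | Deref _ => fun args => singT (args ord0)
  | Fn g k => fun args => App (Fn g k.+1) args
  | _ => fun=> emptyT V b TPtr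
  end.

Fixpoint tscope (S : signature) (V : sty S -> Type) b (A : sty S)
    (t : term V b A) : term V b SetOfPtr :=
  match t with
  | Var b _ _ => emptyT V b TPtr
  | App _ f args =>
      foldr (@unionT S V _ TPtr) (fn_scope args)
        [seq tscope (args i) | i <- enum 'I_(farity f)]
  | Cond _ _ c t u => unionT (tscope c) (Cond c (tscope t) (tscope u))
  | Pre _ _ => emptyT V true TPtr
  | PScope rho k => PScope rho k.+1
  end.

Inductive param (S : signature) (f : sg_fn S) : sty S -> Type :=
| Param (i : 'I_(fn_arity f)) : param f (fn_dom f i).
Arguments Param {S} f i.

Definition definitions (S : signature) : Type :=
  forall f : sg_fn S, term (param f) false (fn_cod f).

Fixpoint body (S : signature) (D : definitions S) (f : sg_fn S) (k : nat) :
    term (param f) false (fcod (Fn f k)) :=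
  match k return term (param f) false (fcod (Fn f k)) with
  | 0 => D f
  | k'.+1 => tscope (body D f k')
  end.

(* A logical variable is a typed name. *)
Definition lname (S : signature) (_ : sty S) : Type := nat.
Definition lvar (S : signature) : Type := (sty S * nat)%type.
Notation aterm S := (term (@lname S) true).

(* [FEq] is the weak (strict) equality [=], [FSeq] the strong (total) equality
   [==] and [FDef t] the definedness assertion for [t]. *)
Inductive formula (S : signature) : Type :=
| FPred of nat
| FBool of aterm S TBool
| FEq A of aterm S A & aterm S A
| FSeq A of aterm S A & aterm S A
| FDef A of aterm S A
| FAnd of formula S & formula S
| FNot of formula S
| FAll of sty S & nat & formula S.
Arguments FPred {S} rho.

Fixpoint fbar (S : signature) (phi : formula S) : formula S :=
  match phi with
  | FPred rho => FPred rho
  | FBool t => FBool (tbar t)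
  | FEq _ t u => FEq (tbar t) (tbar u)
  | FSeq _ t u => FSeq (tbar t) (tbar u)
  | FDef _ t => FDef (tbar t)
  | FAnd p q => FAnd (fbar p) (fbar q)
  | FNot p => FNot (fbar p)
  | FAll A x p => FAll A x (fbar p)
  end.

(* The bound variables of [phi] become free in [fscope phi]; this is meant for
   formulas whose quantified variables are renamed apart. *)
Fixpoint fscope (S : signature) (phi : formula S) : aterm S SetOfPtr :=
  match phi with
  | FPred rho => PScope rho 0
  | FBool t => tscope t
  | FEq _ t u => unionT (tscope t) (tscope u)
  | FSeq _ t u => unionT (tscope t) (tscope u)
  | FDef _ t => tscope t
  | FAnd p q => unionT (fscope p) (fscope q)
  | FNot p => fscope p
  | FAll _ _ p => fscope p
  end.

Definition disjointF (S : signature) (t e : aterm S SetOfPtr) : formula S :=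
  FEq (interT t e) (emptyT (@lname S) true TPtr).

Definition Outlying (S : signature) (phi : formula S) (e : aterm S SetOfPtr) :
    formula S :=
  FAnd phi (disjointF (fscope phi) e).

Fixpoint tfree (S : signature) (x : lvar S) b A (t : term (@lname S) b A) :
    Prop :=
  match t with
  | Var _ B y => (B, y) = x
  | App _ f args => exists i, tfree x (args i)
  | Cond _ _ c t u => tfree x c \/ tfree x t \/ tfree x u
  | Pre _ t => tfree x t
  | PScope _ _ => False
  end.

Fixpoint ffree (S : signature) (x : lvar S) (phi : formula S) : Prop :=
  match phi with
  | FPred _ => False
  | FBool t => tfree x t
  | FEq _ t u => tfree x t \/ tfree x u
  | FSeq _ t u => tfree x t \/ tfree x u
  | FDef _ t => tfree x t
  | FAnd p q => ffree x p \/ ffree x q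
  | FNot p => ffree x p
  | FAll A y p => (A, y) <> x /\ ffree x p
  end.

Fixpoint bvars (S : signature) (phi : formula S) : list (lvar S) :=
  match phi with
  | FAnd p q => bvars p ++ bvars q
  | FNot p => bvars p
  | FAll A x p => (A, x) :: bvars p
  | _ => [::]
  end.

Definition renamed_apart (S : signature) (phi : formula S) : Prop :=
  List.NoDup (bvars phi) /\ forall x, List.In x (bvars phi) -> ~ ffree x phi.

Fixpoint tpred (S : signature) (rho : nat) b A (t : term (@lname S) b A) :
    Prop :=
  match t with
  | Var _ _ _ => False
  | App _ f args => exists i, tpred rho (args i)
  | Cond _ _ c t u => tpred rho c \/ tpred rho t \/ tpred rho u
  | Pre _ _ => False
  | PScope sigma _ => sigma = rho
  end.

Fixpoint fpred (S : signature) (rho : nat) (phi : formula S) : Prop :=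
  match phi with
  | FPred sigma => sigma = rho
  | FBool t => tpred rho t
  | FEq _ t u => tpred rho t \/ tpred rho u
  | FSeq _ t u => tpred rho t \/ tpred rho u
  | FDef _ t => tpred rho t
  | FAnd p q => fpred rho p \/ fpred rho q
  | FNot p => fpred rho p
  | FAll _ _ p => fpred rho p
  end.

Fixpoint tsubst (S : signature) (rho : nat) (r : formula S) b A
    (t : term (@lname S) b A) : term (@lname S) b A :=
  match t with
  | Var b _ x => Var b x
  | App _ f args => App f (fun i => tsubst rho r (args i))
  | Cond _ _ c t u => Cond (tsubst rho r c) (tsubst rho r t) (tsubst rho r u)
  | Pre _ t => Pre t
  | PScope sigma k =>
      if sigma == rho then iter k (fun t => tscope t) (fscope r)
      else PScope sigma k
  end.

Fixpoint fsubst (S : signature) (rho : nat) (r phi : formula S) : formula S :=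
  match phi with
  | FPred sigma => if sigma == rho then r else FPred sigma
  | FBool t => FBool (tsubst rho r t)
  | FEq _ t u => FEq (tsubst rho r t) (tsubst rho r u)
  | FSeq _ t u => FSeq (tsubst rho r t) (tsubst rho r u)
  | FDef _ t => FDef (tsubst rho r t)
  | FAnd p q => FAnd (fsubst rho r p) (fsubst rho r q)
  | FNot p => FNot (fsubst rho r p)
  | FAll A x p => FAll A x (fsubst rho r p)
  end.

(* No variable of [r] is captured when [r] replaces [rho] in [phi]. *)
Fixpoint free_for (S : signature) (r : formula S) (rho : nat)
    (phi : formula S) : Prop :=
  match phi with
  | FAnd p q => free_for r rho p /\ free_for r rho q
  | FNot p => free_for r rho p
  | FAll A x p =>
      (fpred rho p -> ~ ffree (A, x) r /\ ~ List.In (A, x) (bvars r)) /\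
      free_for r rho p
  | _ => True
  end.

Inductive tswap (S : signature) :
    forall b A, term (@lname S) b A -> term (@lname S) b A -> Prop :=
| tswap_pre A (t : term (@lname S) false A) : tswap (Pre t) (lift t)
| tswap_lift A (t : term (@lname S) false A) : tswap (lift t) (Pre t)
| tswap_refl b A (t : term (@lname S) b A) : tswap t t
| tswap_app b f (ts us : forall i, term (@lname S) b (@fdom S f i)) :
    (forall i, tswap (ts i) (us i)) -> tswap (App f ts) (App f us)
| tswap_cond b A c c' (t t' u u' : term (@lname S) b A) :
    tswap c c' -> tswap t t' -> tswap u u' ->
    tswap (Cond c t u) (Cond c' t' u').

Inductive fswap (S : signature) : formula S -> formula S -> Prop :=
| fswap_pred rho : fswap (FPred rho) (FPred rho)
| fswap_bool t t' : tswap t t' -> fswap (FBool t) (FBool t')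
| fswap_eq A (t t' u u' : aterm S A) :
    tswap t t' -> tswap u u' -> fswap (FEq t u) (FEq t' u')
| fswap_seq A (t t' u u' : aterm S A) :
    tswap t t' -> tswap u u' -> fswap (FSeq t u) (FSeq t' u')
| fswap_def A (t t' : aterm S A) : tswap t t' -> fswap (FDef t) (FDef t')
| fswap_and p p' q q' :
    fswap p p' -> fswap q q' -> fswap (FAnd p q) (FAnd p' q')
| fswap_not p p' : fswap p p' -> fswap (FNot p) (FNot p')
| fswap_all A x p p' : fswap p p' -> fswap (FAll A x p) (FAll A x p').

Record structure (S : signature) : Type := Structure {
  addr : Type;                 (* memory units, i.e. non-nil pointers *)
  carrier : sg_base S -> Type;
  carrier_inh : forall b, inhabited (carrier b);
  value := fix value (A : sty S) : Type :=
    match A with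
    | TBool => bool
    | TPtr => option addr      (* [None] is nil *)
    | TBase b => carrier b
    | TSet B => set (value B)
    end;
  pvar_addr : sg_pvar S -> addr;
  pvar_addr_inj : injective pvar_addr;
  op_val : forall o : sg_op S,
    (forall i, value (op_dom o i)) -> option (value (op_cod o))
}.

Record cell (S : signature) (M : structure S) : Type := Cell {
  cell_ty : sty S;
  cell_storable : storable cell_ty;
  cell_val : value M cell_ty
}.
Arguments Cell {S M cell_ty}.

Definition memory (S : signature) (M : structure S) : Type :=
  addr M -> cell M.

Inductive holds_value (S : signature) (M : structure S) :
    cell M -> forall A, value M A -> Prop :=
| HoldsValue A (h : storable A) (v : value M A) : holds_value (Cell h v) v.

(* Graph of the interpretation of the symbols that are not user-defined. *)
Definition fapply (S : signature) (M : structure S) (m : memory M)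
    (f : fsym S) :
    (forall i, value M (@fdom S f i)) -> value M (fcod f) -> Prop :=
  match f return
    (forall i, value M (@fdom S f i)) -> value M (fcod f) -> Prop with
  | Op o => fun vs v => op_val vs = Some v
  | AddrOf x => fun _ v => v = Some (pvar_addr M x)
  | Nil => fun _ v => v = None
  | Empty A => fun _ v => v = set0
  | Sing A => fun vs v => v = set1 (vs ord0)
  | Union A => fun vs v => v = setU (vs ord0) (vs ord_max)
  | Inter A => fun vs v => v = setI (vs ord0) (vs ord_max)
  | Deref A => fun vs v =>
      exists2 a, vs ord0 = Some a & holds_value (m a) v
  | Fn _ _ => fun _ _ => False
  end.

Definition env (S : signature) (M : structure S) (V : sty S -> Type) : Type :=
  forall A, V A -> value M A.

Definition param_env (S : signature) (M : structure S) (f : sg_fn S)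
    (vs : forall i, value M (fn_dom f i)) : env M (param f) :=
  fun A x => match x in param _ B return value M B with
             | Param i => vs i
             end.

(* [eval D sc pre cur s t v]: [t] is defined and has value [v], where memory is
   [cur] and pre-state terms are evaluated in [pre].  All symbols are strict and
   user-defined functions are the least solutions of their definitions.  [sc]
   gives the (possibly undefined) scopes of the predicate variables. *)
Inductive eval (S : signature) (D : definitions S) (M : structure S)
    (sc : nat -> nat -> option (set (value M TPtr))) (pre : memory M) :
    forall (cur : memory M) (V : sty S -> Type) (s : env M V) b A,
      term V b A -> value M A -> Prop :=
| eval_var cur V (s : env M V) b A (x : V A) :
    eval D sc pre cur s (Var b x) (s A x)
| eval_app cur V (s : env M V) b f
    (args : forall i, term V b (@fdom S f i)) vs v :
    (forall i, eval D sc pre cur s (args i) (vs i)) ->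
    fapply cur vs v ->
    eval D sc pre cur s (App f args) v
| eval_fn cur V (s : env M V) b f k
    (args : forall i, term V b (@fdom S (Fn f k) i)) vs v :
    (forall i, eval D sc pre cur s (args i) (vs i)) ->
    eval D sc pre cur (param_env (f := f) vs) (body D f k) v ->
    eval D sc pre cur s (App (Fn f k) args) v
| eval_cond cur V (s : env M V) b A c (t u : term V b A) (g : bool) v :
    eval D sc pre cur s c (g : value M TBool) ->
    eval D sc pre cur s (if g then t else u) v ->
    eval D sc pre cur s (Cond c t u) v
| eval_pre cur V (s : env M V) A (t : term V false A) v :
    eval D sc pre pre s t v ->
    eval D sc pre cur s (Pre t) v
| eval_pscope cur V (s : env M V) rho k (X : value M SetOfPtr) :
    sc rho k = Some X ->
    eval D sc pre cur s (PScope rho k) X.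

Definition valuation (S : signature) (M : structure S) : Type :=
  env M (@lname S).

(* Interpretation of predicate variables (three-valued) and of their iterated
   memory scopes; the memories are the pre-state and the current one. *)
Record pinterp (S : signature) (M : structure S) : Type := PInterp {
  pi_truth : nat -> memory M -> memory M -> valuation M -> option bool;
  pi_scope : nat -> nat -> memory M -> memory M -> valuation M ->
    option (set (value M TPtr))
}.

Definition agree_off (S : signature) (M : structure S) (x : lvar S)
    (s s' : valuation M) : Prop :=
  forall A y, (A, y) <> x -> s' A y = s A y.

(* [sat D I pre cur s true phi]: [phi] is true; [sat D I pre cur s false phi]:
   [phi] is false.  [phi] is undefined when neither holds. *)
Fixpoint sat (S : signature) (D : definitions S) (M : structure S)
    (I : pinterp M) (pre cur : memory M) (s : valuation M) (b : bool)
    (phi : formula S) : Prop :=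
  let ev A (t : aterm S A) (v : value M A) :=
    eval D (fun rho k => pi_scope I rho k pre cur s) pre cur s t v in
  match phi with
  | FPred rho => pi_truth I rho pre cur s = Some b
  | FBool t => ev TBool t b
  | FEq A t u =>
      exists v w, [/\ ev A t v, ev A u w & if b then v = w else v <> w]
  | FSeq A t u =>
      if b then forall v, ev A t v <-> ev A u v
      else ~ forall v, ev A t v <-> ev A u v
  | FDef A t => if b then exists v, ev A t v else ~ exists v, ev A t v
  | FAnd p q =>
      if b then sat D I pre cur s true p /\ sat D I pre cur s true q
      else sat D I pre cur s false p \/ sat D I pre cur s false q
  | FNot p => sat D I pre cur s (~~ b) p
  | FAll A x p =>
      if b then
        forall s', agree_off (A, x) s s' -> sat D I pre cur s' true p
      else
        exists2 s', agree_off (A, x) s s' & sat D I pre cur s' false p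
  end.

(* Implications between formulas are consequences of the three-valued logic:
   the conclusion is true whenever the premise is true.  Pre-conditions are
   interpreted in the pre-state only. *)
Definition pre_implies (S : signature) (D : definitions S) (M : structure S)
    (P Q : formula S) : Prop :=
  forall (I : pinterp M) (m : memory M) (s : valuation M),
    sat D I m m s true P -> sat D I m m s true Q.

Definition post_implies (S : signature) (D : definitions S) (M : structure S)
    (P Q : formula S) : Prop :=
  forall (I : pinterp M) (pre post : memory M) (s : valuation M),
    sat D I pre post s true P -> sat D I pre post s true Q.

Record triple (S : signature) (stmt : Type) : Type := Triple {
  precond : formula S;
  prog : stmt;
  postcond : formula S
}.

(* [derivable D M rules]: derivability in the logic whose rules are those in
   [rules] (pairs of a list of premises and a conclusion; axioms have no
   premise), substitution for predicate variables, interchange of terms and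
   pre-state terms in pre-conditions, and consequence. *)
Inductive derivable (S : signature) (D : definitions S) (M : structure S)
    (stmt : Type) (rules : list (triple S stmt) -> triple S stmt -> Prop) :
    triple S stmt -> Prop :=
| derivable_rule prems concl :
    rules prems concl ->
    (forall tr, List.In tr prems -> derivable D M rules tr) ->
    derivable D M rules concl
| derivable_subst rho r P s Q :
    derivable D M rules (Triple P s Q) ->
    renamed_apart r ->
    (forall x, List.In x (bvars r) -> ~ ffree x P /\ ~ ffree x Q) ->
    free_for r rho P -> free_for r rho Q ->
    derivable D M rules (Triple (fsubst rho r P) s (fsubst rho r Q))
| derivable_swap P P' s Q :
    fswap P P' ->
    derivable D M rules (Triple P s Q) ->
    derivable D M rules (Triple P' s Q)
| derivable_conseq P P' s Q Q' :
    derivable D M rules (Triple P s Q) ->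
    pre_implies D M P' P -> post_implies D M Q Q' ->
    derivable D M rules (Triple P' s Q').

(* Main.v *)
Require Import Defs.
From Stdlib Require List.
From mathcomp Require Import all_boot.
From mathcomp Require Import boolp classical_sets.

(** Instantiate [rho] by [r] in the derived triple. Freshness of [rho] leaves
    [e], [p] and [q] unchanged, so the pre-condition becomes
    [Outlying r e /\ p]. Interchanging pre-state terms with current ones turns
    [r] and its scope into [fbar r] and [tbar (fscope r)]; the disjointness
    conjunct is then implied by [p /\ fbar r] and is dropped by consequence. *)

Lemma tsubst_fresh (S : signature) (rho : nat) (r : formula S) b A
    (t : term (@lname S) b A) : ~ tpred rho t -> tsubst rho r t = t.
Proof.
elim: t => //= [b' f args IH fresh|b' B c IHc t IHt u IHu fresh|sigma k fresh].
- congr App; apply: functional_extensionality_dep => i.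
  by apply: IH => rho_i; apply: fresh; exists i.
- by rewrite IHc ?IHt ?IHu //; tauto.
- by case: eqP.
Qed.

Lemma fsubst_fresh (S : signature) (rho : nat) (r phi : formula S) :
  ~ fpred rho phi -> fsubst rho r phi = phi.
Proof.
elim: phi => /= [sigma|t|A t u|A t u|A t|p IHp q IHq|p IHp|A x p IHp] fresh.
- by case: eqP.
- by rewrite tsubst_fresh.
- by rewrite !tsubst_fresh //; tauto.
- by rewrite !tsubst_fresh //; tauto.
- by rewrite tsubst_fresh.
- by rewrite IHp ?IHq //; tauto.
- by rewrite IHp.
- by rewrite IHp.
Qed.

(** The no-capture condition at a quantifier is guarded by an occurrence of [rho] below it, so here
    it is vacuous. *)
Lemma free_for_fresh (S : signature) (rho : nat) (r phi : formula S) :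
  ~ fpred rho phi -> free_for r rho phi.
Proof. by elim: phi => //= [p IHp q IHq|A x p IHp] fresh; tauto. Qed.

Lemma tsubst_emptyT (S : signature) (rho : nat) (r : formula S) b (A : sty S) :
  tsubst rho r (emptyT (@lname S) b A) = emptyT (@lname S) b A.
Proof. by apply: tsubst_fresh => -[[]]. Qed.

(** The arguments of [interT] form a function branching on [i == ord0]; substitution passes through
    the branching only pointwise, hence extensionality. *)
Lemma tsubst_interT (S : signature) (rho : nat) (r : formula S) b (A : sty S)
    (t u : term (@lname S) b (TSet A)) :
  tsubst rho r (interT t u) = interT (tsubst rho r t) (tsubst rho r u).
Proof.
apply: (f_equal (@App S (@lname S) b (Inter A))).
by apply: functional_extensionality_dep => i; case: (i == ord0).
Qed.

Lemma tfree_interT (S : signature) (x : lvar S) b (A : sty S)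
    (t u : term (@lname S) b (TSet A)) :
  tfree x (interT t u) -> tfree x t \/ tfree x u.
Proof. by case=> i; case: (i == ord0); [left|right]. Qed.

Lemma fsubst_Outlying (S : signature) (rho : nat) (r : formula S)
    (e : term (@lname S) true SetOfPtr) :
  ~ tpred rho e -> fsubst rho r (Outlying (FPred rho) e) = Outlying r e.
Proof.
move=> fresh.
rewrite -[LHS]/(FAnd (fsubst rho r (FPred rho))
  (FEq (tsubst rho r (interT (PScope rho 0) e)) (tsubst rho r (emptyT _ _ _)))).
(* At scope index 0 the iterate of [tscope] is trivial, so [PScope rho 0] becomes [fscope r]
   itself. *)
by rewrite tsubst_interT tsubst_emptyT (tsubst_fresh _ _ _ _ _ e) //= eqxx.
Qed.

Lemma ffree_Outlying_FPred (S : signature) (x : lvar S) (rho : nat)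
    (e : term (@lname S) true SetOfPtr) :
  ffree x (Outlying (FPred rho) e) -> tfree x e.
Proof. by case=> //; case=> [/tfree_interT[]|[[]]]. Qed.

(** [tbar] only turns [Pre t] into [lift t], an instance of [tswap_pre]; congruence and reflexivity
    do the rest. *)
Lemma tswap_tbar (S : signature) b A (t : term (@lname S) b A) :
  tswap t (tbar t).
Proof. by elim: t => /= *; constructor. Qed.

Lemma fswap_refl (S : signature) (phi : formula S) : fswap phi phi.
Proof. by elim: phi => *; constructor => //; apply: tswap_refl. Qed.

Lemma fswap_fbar (S : signature) (phi : formula S) : fswap phi (fbar phi).
Proof. by elim: phi => /= *; constructor => //; apply: tswap_tbar. Qed.

(** Interchange may be made at chosen places only: [e] keeps its pre-state terms, to match
    [scope_disjoint]. *)
Lemma fswap_disjointF_tbar (S : signature)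
    (t e : term (@lname S) true SetOfPtr) :
  fswap (disjointF t e) (disjointF (tbar t) e).
Proof.
constructor; last exact: tswap_refl.
apply: (@tswap_app S true (Inter TPtr)) => i.
by case: (i == ord0); [apply: tswap_tbar|apply: tswap_refl].
Qed.

Theorem theorem1 (S : signature) (D : definitions S) (M : structure S)
    (stmt : Type) (rules : list (triple S stmt) -> triple S stmt -> Prop)
    (rho : nat) (e : term (@lname S) true SetOfPtr) (p q r : formula S)
    (s : stmt)
    (rho_fresh : ~ tpred rho e /\ ~ fpred rho p /\ ~ fpred rho q)
    (r_apart : renamed_apart r)
    (r_apart_ctx : forall x, List.In x (bvars r) ->
       ~ tfree x e /\ ~ ffree x p /\ ~ ffree x q)
    (outlying_derivable :
       derivable D M rules
         (Triple (FAnd (Outlying (FPred rho) e) p) s (FAnd (FPred rho) q)))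
    (scope_disjoint :
       pre_implies D M (FAnd p (fbar r)) (disjointF (tbar (fscope r)) e)) :
  derivable D M rules (Triple (FAnd p (fbar r)) s (FAnd q r)).
Proof.
case: rho_fresh => fresh_e [fresh_p fresh_q].
have instantiated :
    derivable D M rules (Triple (FAnd (Outlying r e) p) s (FAnd r q)).
  have -> : FAnd (Outlying r e) p =
      fsubst rho r (FAnd (Outlying (FPred rho) e) p).
    rewrite -[RHS]/(FAnd (fsubst rho r (Outlying (FPred rho) e))
                         (fsubst rho r p)).
    by rewrite fsubst_Outlying // fsubst_fresh.
  have -> : FAnd r q = fsubst rho r (FAnd (FPred rho) q).
    by rewrite /= eqxx fsubst_fresh.
  apply: derivable_subst => //.
  - move=> x /r_apart_ctx[free_e [free_p free_q]].
    by split=> -[] // /ffree_Outlying_FPred.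
  (* No capture: [Outlying (FPred rho) e] has no quantifier, and [rho] does not occur in [p]. *)
  - by do !split=> //; apply: free_for_fresh.
  - by split=> //; apply: free_for_fresh.
have swapped : derivable D M rules
    (Triple (FAnd (FAnd (fbar r) (disjointF (tbar (fscope r)) e)) p) s
            (FAnd r q)).
  apply: derivable_swap instantiated.
  apply: fswap_and (fswap_refl _ _).
  exact: fswap_and (fswap_fbar _ _) (fswap_disjointF_tbar _ _ _).
apply: derivable_conseq swapped _ _.
- move=> I m v pr; have disj := scope_disjoint I m v pr.
  by case: pr => sat_p sat_r; split.
(* The post-condition was not swapped, so [r] still has its pre-state terms; only the conjuncts
   change order. *)
- by move=> I pre post v [sat_r sat_q]; split.
Qed.
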